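(* Let $(a,c)\in\mathbb{R}^2$ be such that $T$ has a 4-cycle with symbolic sequence $1\to 3\to 4\to 4$, i.e. four distinct points $r_2\in Q_1$, $r_3\in Q_3$, $r_4\in Q_4$, $r_1\in Q_4$ with $r_3=T_1(r_2)$, $r_4=T_3(r_3)$, $r_1=T_4(r_4)$, $r_2=T_4(r_1)$. The stability of this cycle is determined by the Jacobian $J_4J_4J_3J_1$, and the cycle is locally stable if and only if the following conditions hold: (1) $(c^2-a^2)^2<1$; (2) $2-2a^2+c^4+(c^2-a^2)^2>0$; (3) $2a^2-c^4+(c^2-a^2)^2>0$.
   Context: For real parameters $a,c$, $T:\mathbb{R}^2\to\mathbb{R}^2$ is $T(x,y)=(|x|+ay-1,\;x+c|y|-1)$. The closed quadrants are $Q_1=\{x\ge 0,y\ge 0\}$, $Q_2=\{x\le 0,y\ge 0\}$, $Q_3=\{x\le 0,y\le 0\}$, $Q_4=\{x\ge 0,y\le 0\}$. On $Q_1$, $Q_3$, $Q_4$ the map $T$ coincides respectively with $T_1(x,y)=(x+ay-1,x+cy-1)$, $T_3(x,y)=(-x+ay-1,x-cy-1)$, $T_4(x,y)=(x+ay-1,x-cy-1)$, with linear parts $J_1=\begin{pmatrix}1&a\\1&c\end{pmatrix}$, $J_3=\begin{pmatrix}-1&a\\1&-c\end{pmatrix}$, $J_4=\begin{pmatrix}1&a\\1&-c\end{pmatrix}$. The cycle is called locally stable if all eigenvalues $\lambda\in\mathbb{C}$ of the Jacobian product $J_4J_4J_3J_1$ along the cycle satisfy $|\lambda|<1$. *)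

(* Defs.v *)
From HB Require Import structures.
From mathcomp Require Import all_boot all_order all_algebra.
From mathcomp Require Import all_classical all_reals all_analysis.
From mathcomp Require Export complex.

Set Implicit Arguments.
Unset Strict Implicit.
Unset Printing Implicit Defensive.

Import Order.TTheory GRing.Theory Num.Theory.
Import numFieldNormedType.Exports.

Local Open Scope classical_set_scope.
Local Open Scope ring_scope.

Section FourCycle.
Variable R : realType.
Implicit Types (a c : R) (p : 'cV[R]_2).

(* The plane is the space of column vectors, on which the matrices J_i act
   by left multiplication. *)
Definition vec2 (x y : R) : 'cV[R]_2 :=
  \col_(i < 2) (if i == 0 then x else y).

Definition mx22 (m00 m01 m10 m11 : R) : 'M[R]_2 :=
  \matrix_(i < 2, j < 2)
    (if i == 0 then if j == 0 then m00 else m01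
     else if j == 0 then m10 else m11).

Definition xc p : R := p 0 0.
Definition yc p : R := p 1 0.

Definition T a c p : 'cV[R]_2 :=
  vec2 (`|xc p| + a * yc p - 1) (xc p + c * `|yc p| - 1).

Definition T1 a c p : 'cV[R]_2 :=
  vec2 (xc p + a * yc p - 1) (xc p + c * yc p - 1).
Definition T3 a c p : 'cV[R]_2 :=
  vec2 (- xc p + a * yc p - 1) (xc p - c * yc p - 1).
Definition T4 a c p : 'cV[R]_2 :=
  vec2 (xc p + a * yc p - 1) (xc p - c * yc p - 1).

Definition J1 a c : 'M[R]_2 := mx22 1 a 1 c.
Definition J3 a c : 'M[R]_2 := mx22 (- 1) a 1 (- c).
Definition J4 a c : 'M[R]_2 := mx22 1 a 1 (- c).

Definition Q1 : set 'cV[R]_2 := [set p | 0 <= xc p /\ 0 <= yc p].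
Definition Q3 : set 'cV[R]_2 := [set p | xc p <= 0 /\ yc p <= 0].
Definition Q4 : set 'cV[R]_2 := [set p | 0 <= xc p /\ yc p <= 0].

Lemma T_Q1 a c p : Q1 p -> T a c p = T1 a c p.
Proof. by move=> [hx hy]; rewrite /T /T1 !ger0_norm. Qed.

Lemma T_Q3 a c p : Q3 p -> T a c p = T3 a c p.
Proof. by move=> [hx hy]; rewrite /T /T3 !ler0_norm // mulrN. Qed.

Lemma T_Q4 a c p : Q4 p -> T a c p = T4 a c p.
Proof.
by move=> [hx hy]; rewrite /T /T4 (ger0_norm hx) (ler0_norm hy) mulrN.
Qed.

(* r2 -> r3 -> r4 -> r1 -> r2 is a 4-cycle of T with symbolic sequence
   1 -> 3 -> 4 -> 4. *)
Definition cycle1344 a c (r2 r3 r4 r1 : 'cV[R]_2) : Prop :=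
  [/\ uniq [:: r2; r3; r4; r1],
      [/\ Q1 r2, Q3 r3, Q4 r4 & Q4 r1] &
      [/\ r3 = T a c r2, r4 = T a c r3, r1 = T a c r4 & r2 = T a c r1]].

Lemma cycle1344E a c r2 r3 r4 r1 :
  cycle1344 a c r2 r3 r4 r1 <->
  [/\ uniq [:: r2; r3; r4; r1],
      [/\ Q1 r2, Q3 r3, Q4 r4 & Q4 r1] &
      [/\ r3 = T1 a c r2, r4 = T3 a c r3, r1 = T4 a c r4 & r2 = T4 a c r1]].
Proof.
split=> -[u [q2 q3 q4 q1] e]; split=> //; move: e;
  by rewrite (T_Q1 _ _ q2) (T_Q3 _ _ q3) (T_Q4 _ _ q4) (T_Q4 _ _ q1).
Qed.

(* [eigenvalue] is phrased with row vectors, which does not change the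
   spectrum.  The order on R[i] is the partial one: z < 1 forces z to be real,
   as the modulus is. *)
Definition locally_stable1344 a c : Prop :=
  forall lambda : R[i],
    eigenvalue (map_mx (real_complex R)
                  (J4 a c *m J4 a c *m J3 a c *m J1 a c)) lambda ->
    `|lambda| < 1.

End FourCycle.

(* Main.v *)
Require Import Defs.
From mathcomp Require Import all_boot all_order all_algebra.
From mathcomp Require Import all_classical all_reals all_analysis.
From mathcomp Require Import ring lra.
Import Order.TTheory GRing.Theory Num.Theory.
Import numFieldNormedType.Exports.
Local Open Scope ring_scope.

(** Each branch [T1], [T3], [T4] is affine, with linear part [J1], [J3], [J4].
    Hence the composite of the branches followed by the cycle is
    differentiable, and by the chain rule its differential is multiplication
    by the product [J4 *m J4 *m J3 *m J1].

    The eigenvalues of this real 2 x 2 matrix are the complex roots of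
    [z^2 - t z + d], where [t] is its trace and [d] its determinant.  Here
    [t = 2 a^2 - 1 - c^4], and [d = (c^2 - a^2)^2] because [J1] and [J3] have
    determinant [c - a] and both factors [J4] have determinant [- (c + a)].
    By the Schur-Cohn (or Jury) criterion [schur_cohn2], both roots lie in the
    open unit disc if and only if [d < 1], [1 - t + d > 0] and
    [1 + t + d > 0]; after substitution these are the three conditions of the
    theorem. *)

(** The sum over the entries exhibits multiplication by [A] as a finite sum of
    coordinates times constant matrices, all of them continuous. *)
Lemma mulmx_continuous (K : numFieldType) (m n p : nat) (A : 'M[K]_(m, n)) :
  continuous (mulmx A : 'M[K]_(n, p) -> 'M[K]_(m, p)).
Proof.
have -> : mulmx A =
    (fun B : 'M[K]_(n, p) => \sum_i \sum_j B i j *: (A *m delta_mx i j)).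
  apply/funext => B; rewrite [in LHS](matrix_sum_delta B) mulmx_sumr.
  apply: eq_bigr => i _; rewrite mulmx_sumr; apply: eq_bigr => j _.
  by rewrite -scalemxAr.
have addc := @add_continuous 'M[K]_(m, p).
apply: (continuous_big addc) => i _; apply: (continuous_big addc) => j _ B.
apply: (continuous_comp (f := fun C : 'M[K]_(n, p) => C i j)
                        (g := fun k => k *: (A *m delta_mx i j))).
  exact: coord_continuous.
exact: scalel_continuous.
Qed.

Lemma is_diff_affine (K : numFieldType) (m n p : nat) (A : 'M[K]_(m, n))
    (b : 'M[K]_(m, p)) (x : 'M[K]_(n, p)) :
  is_diff x (fun q => A *m q + b) (mulmx A).
Proof.
have dA : is_diff x (mulmx A : 'M[K]_(n, p) -> 'M[K]_(m, p)) (mulmx A).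
  apply: DiffDef.
    by apply: linear_differentiable; exact: mulmx_continuous.
  by rewrite diff_lin //; exact: mulmx_continuous.
have := is_diffD dA (is_diff_cst b x); rewrite addr0; exact.
Qed.

Lemma det_mx2 (R : comNzRingType) (A : 'M[R]_2) :
  \det A = A 0 0 * A 1 1 - A 0 1 * A 1 0.
Proof.
have lift01 : lift (0 : 'I_2) 0 = 1 by apply: val_inj.
have lift10 : lift (1 : 'I_2) 0 = 0 by apply: val_inj.
rewrite (expand_det_row _ 0) 2!big_ord_recl big_ord0 /cofactor !det_mx11 !mxE.
by rewrite !lift01 !lift10 /= expr0 expr1 mul1r addr0 mulN1r mulrN.
Qed.

Lemma mxtrace2 (R : pzRingType) (A : 'M[R]_2) : \tr A = A 0 0 + A 1 1.
Proof.
by rewrite /mxtrace 2!big_ord_recl big_ord0 addr0; congr (_ + A _ _);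
  apply: val_inj.
Qed.

(** In dimension 2 the characteristic polynomial is determined by the trace and
    the determinant, which commute with the embedding of the reals into the
    complex numbers. *)
Lemma eigenvalue_mx2 (F : fieldType) (A : 'M[F]_2) (z : F) :
  eigenvalue A z = (z ^+ 2 - \tr A * z + \det A == 0).
Proof.
rewrite eigenvalue_root_char rootE /char_poly det_mx2.
rewrite -[in LHS]horner_evalE.
rewrite rmorphB !rmorphM /= !horner_evalE !mxE /= !hornerE mxtrace2 det_mx2.
by congr (_ == 0); ring.
Qed.

Lemma normC_lt1 (R : rcfType) (x y : R) :
  (`|Complex x y| < 1) = (x ^+ 2 + y ^+ 2 < 1).
Proof.
rewrite normc_def /= (ltcR _ 1).
rewrite -[X in _ < X]sqrtr1 ltr_sqrt //.
Qed.

(** Real and imaginary parts of the equation.  The imaginary part factors: a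
    root is either real, or has real part [t / 2]. *)
Lemma quadratic_complexE (R : rcfType) (t d x y : R) :
  ((Complex x y) ^+ 2 - real_complex R t * Complex x y + real_complex R d == 0)
  = (x ^+ 2 - y ^+ 2 - t * x + d == 0) && (y * (2 * x - t) == 0).
Proof.
rewrite eq_complex /= expr2 /=.
by congr andb; congr (_ == _); ring.
Qed.

(** Write [p z = z^2 - t z + d], with roots [u] and [v].  Then
    [1 - t + d = p 1 = (1 - u) (1 - v)], [1 + t + d = p (-1) = (1 + u) (1 + v)]
    and [d = u v].  If the roots are real, these give one direction at once;
    for the other, [p 1 > 0] places both roots on the same side of [1], and
    [d < 1] excludes that both exceed [1] (likewise at [-1]).  If they are not
    real, they are conjugate, so [d] is their squared modulus and [p > 0] on
    the whole real line. *)
Lemma schur_cohn2 (R : rcfType) (t d : R) :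
  (forall z : complex R,
     z ^+ 2 - real_complex R t * z + real_complex R d = 0 -> `|z| < 1) <->
  [/\ d < 1, 0 < 1 - t + d & 0 < 1 + t + d].
Proof.
split=> [stable | [d1 pm pp] [x y] /eqP].
- have [disc | disc] := lerP 0 (t ^+ 2 - 4 * d).
  + set s := Num.sqrt (t ^+ 2 - 4 * d).
    have s2 : s ^+ 2 = t ^+ 2 - 4 * d by rewrite sqr_sqrtr.
    have rootlt u : u ^+ 2 - t * u + d = 0 -> -1 < u < 1.
      move=> /eqP hu; rewrite -ltr_norml -sqrtr_sqr -[ltRHS]sqrtr1 ltr_sqrt //.
      have := stable (Complex u 0); rewrite normC_lt1 expr0n addr0; apply.
      by apply/eqP; rewrite quadratic_complexE expr0n subr0 mul0r hu eqxx.
    have /andP[p1 p2] : -1 < (t + s) / 2 < 1 by apply: rootlt; field: s2.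
    have /andP[m1 m2] : -1 < (t - s) / 2 < 1 by apply: rootlt; field: s2.
    (* [p 1] and [p (-1)] are products of two positive factors. *)
    by split; nra.
  + set s := Num.sqrt (4 * d - t ^+ 2).
    have s2 : s ^+ 2 = 4 * d - t ^+ 2.
      by rewrite sqr_sqrtr // subr_ge0 ltW // -subr_lt0.
    have d1 : d < 1.
      have := stable (Complex (t / 2) (s / 2)); rewrite normC_lt1.
      have -> : (t / 2) ^+ 2 + (s / 2) ^+ 2 = d by field: s2.
      apply; apply/eqP; rewrite quadratic_complexE.
      by apply/andP; split; apply/eqP; field: s2.
    (* [1 -+ t + d] is [(1 -+ t / 2)^2] plus the positive [d - t^2 / 4]. *)
    by split=> //; nra.
- rewrite normC_lt1 quadratic_complexE mulf_eq0 => /andP[/eqP re /orP[]/eqP im].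
  + rewrite im in re *; rewrite expr0n addr0.
    (* The other real root is [t - x], and [x (t - x) = d < 1]. *)
    have x1 : x < 1 by rewrite ltNge; apply/negP => ?; nra.
    have x2 : -1 < x by rewrite ltNge; apply/negP => ?; nra.
    by nra.
  (* Since [t = 2 x], the real part of the equation reads [d = x^2 + y^2]. *)
  + by nra.
Qed.

Lemma cycle_jacobian_trace_det (R : realType) (a c : R) :
  \tr (J4 a c *m J4 a c *m J3 a c *m J1 a c) = 2 * a ^+ 2 - 1 - c ^+ 4 /\
  \det (J4 a c *m J4 a c *m J3 a c *m J1 a c) = (c ^+ 2 - a ^+ 2) ^+ 2.
Proof.
split; last by rewrite !det_mulmx !det_mx2 !mxE /=; ring.
rewrite mxtrace2 !(mxE, big_ord_recl, big_ord0) /=.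
ring.
Qed.

Lemma mx22_affine (R : realType) (m00 m01 m10 m11 k : R) (p : 'cV[R]_2) :
  vec2 (m00 * xc p + m01 * yc p + k) (m10 * xc p + m11 * yc p + k) =
  mx22 m00 m01 m10 m11 *m p + const_mx k.
Proof.
apply/matrixP => i j; rewrite !mxE 2!big_ord_recl big_ord0 !mxE /= addr0.
have -> : lift ord0 ord0 = 1 :> 'I_2 by apply: val_inj.
by rewrite (ord1 j) /xc /yc; case: eqP.
Qed.

Theorem proposition3p18 (R : realType) (a c : R) (r2 r3 r4 r1 : 'cV[R]_2)
  (hcycle : cycle1344 a c r2 r3 r4 r1) :
  is_diff r2 (T4 a c \o T4 a c \o T3 a c \o T1 a c)
    (mulmx (J4 a c *m J4 a c *m J3 a c *m J1 a c))
  /\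
  (locally_stable1344 a c <->
   [/\ (c ^+ 2 - a ^+ 2) ^+ 2 < 1,
       2 - 2 * a ^+ 2 + c ^+ 4 + (c ^+ 2 - a ^+ 2) ^+ 2 > 0 &
       2 * a ^+ 2 - c ^+ 4 + (c ^+ 2 - a ^+ 2) ^+ 2 > 0]).
Proof.
split.
  have affine m00 m01 m10 m11 (f : 'cV[R]_2 -> 'cV[R]_2) :
      (forall p, f p = vec2 (m00 * xc p + m01 * yc p - 1)
                            (m10 * xc p + m11 * yc p - 1)) ->
      forall x, is_diff x f (mulmx (mx22 m00 m01 m10 m11)).
    move=> fE x; have -> : f = fun p => mx22 m00 m01 m10 m11 *m p + const_mx (-1).
      by apply/funext => p; rewrite fE mx22_affine.
    exact: is_diff_affine.
  have dT1 x : is_diff x (T1 a c) (mulmx (J1 a c)).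
    by apply: affine => p; rewrite !mul1r.
  have dT3 x : is_diff x (T3 a c) (mulmx (J3 a c)).
    by apply: affine => p; rewrite mul1r mulN1r mulNr.
  have dT4 x : is_diff x (T4 a c) (mulmx (J4 a c)).
    by apply: affine => p; rewrite !mul1r mulNr.
  have -> : mulmx (J4 a c *m J4 a c *m J3 a c *m J1 a c) =
      mulmx (J4 a c) \o mulmx (J4 a c) \o mulmx (J3 a c) \o mulmx (J1 a c)
      :> ('cV[R]_2 -> 'cV[R]_2).
    by apply/funext => p /=; rewrite !mulmxA.
  by do 3![apply: is_diff_comp => //].
have [trM detM] := cycle_jacobian_trace_det R a c.
rewrite /locally_stable1344.
set M := _ *m J1 a c in trM detM *.
have evE z : eigenvalue (map_mx (real_complex R) M) z =
    (z ^+ 2 - real_complex R (2 * a ^+ 2 - 1 - c ^+ 4) * z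
     + real_complex R ((c ^+ 2 - a ^+ 2) ^+ 2) == 0).
  by rewrite eigenvalue_mx2 trace_map_mx det_map_mx trM detM.
have -> : (forall z, eigenvalue (map_mx (real_complex R) M) z -> `|z| < 1) <->
  [/\ (c ^+ 2 - a ^+ 2) ^+ 2 < 1,
     0 < 1 - (2 * a ^+ 2 - 1 - c ^+ 4) + (c ^+ 2 - a ^+ 2) ^+ 2 &
     0 < 1 + (2 * a ^+ 2 - 1 - c ^+ 4) + (c ^+ 2 - a ^+ 2) ^+ 2].
  rewrite -schur_cohn2; split=> st z; last by rewrite evE => /eqP; exact: st.
  by move=> /eqP; rewrite -evE; exact: st.
by split=> -[? ? ?]; split; lra.
Qed.
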